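(* Let $f\in\mathcal S^0_{\mu_f}(\mathcal X)$ with $\mu_f\ge 0$ and $g\in\mathcal S^0_{\mu_g}(\mathcal Y)$ with $\mu_g\ge 0$. Let $\{\beta_k\}_{k\ge1}$ be a positive nondecreasing sequence with $\lim_{k\to+\infty}\beta_k=+\infty$, let $\{\alpha_k\}_{k\ge1}$ be a positive sequence, and suppose that $\delta,\gamma>0$ satisfy, for every $k\ge 1$, $$\delta\gamma-1\ge 0,\qquad \delta\beta_{k+1}\le \delta\beta_k+\alpha_k\beta_k .$$ Let $\{(x_k,y_k,\lambda_k)\}_{k\ge1}$ be the sequence generated by the Primal-dual Joint Algorithm (defined in the context) and let $(x^*,y^*,\lambda^* )\in\Omega$. Assume that $\{\epsilon_k\}_{k\ge1}$ is a nonincreasing sequence of nonnegative numbers with $\sum_{k=1}^{+\infty}\alpha_k\beta_k\epsilon_k<+\infty$. Then the sequence $\{(x_k,y_k,\lambda_k)\}_{k\ge1}$ is bounded and, as $k\to+\infty$, $$\mathcal L(x_k,y_k,\lambda^* )-\mathcal L(x^*,y^*,\lambda^* )=\mathcal O\!\left(\frac1{\beta_k}\right),\quad |\Phi(x_k,y_k)-\Phi(x^*,y^* )|=\mathcal O\!\left(\frac1{\beta_k}\right),\quad \|Ax_k+By_k-b\|=\mathcal O\!\left(\frac1{\beta_k}\right).$$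
   Context: $\mathcal X,\mathcal Y,\mathcal Z$ are real Hilbert spaces. The problem is $\min_{x\in\mathcal X,y\in\mathcal Y}\Phi(x,y):=f(x)+g(y)$ subject to $Ax+By=b$, where $f:\mathcal X\to\mathbb R\cup\{+\infty\}$, $g:\mathcal Y\to\mathbb R\cup\{+\infty\}$ are proper, convex, lower semicontinuous, $A:\mathcal X\to\mathcal Z$, $B:\mathcal Y\to\mathcal Z$ are continuous linear operators, $b\in\mathcal Z$, and the set $\mathbb S$ of optimal solutions is nonempty. $\mathcal S^0_\mu(\mathcal X)$ ($\mu\ge0$) is the set of proper, closed, lower semicontinuous convex functions $f$ on $\mathcal X$ such that $f(x_1)-f(x_2)-\langle w,x_1-x_2\rangle\ge\frac\mu2\|x_1-x_2\|^2$ for all $x_1,x_2\in\mathcal X$ and $w\in\partial f(x_2)$ (convex subdifferential); similarly for $\mathcal Y$. Lagrangian: $\mathcal L(x,y,\lambda)=f(x)+g(y)+\langle\lambda,Ax+By-b\rangle$. Augmented Lagrangian: $\mathcal L_\theta(x,y,\lambda)=\mathcal L(x,y,\lambda)+\frac\theta2\|Ax+By-b\|^2$. $\Omega$ is the set of saddle points: $(x^*,y^*,\lambda^* )\in\Omega$ iff $\mathcal L(x^*,y^*,\lambda)\le\mathcal L(x^*,y^*,\lambda^* )\le\mathcal L(x,y,\lambda^* )$ for all $(x,y,\lambda)\in\mathcal X\times\mathcal Y\times\mathcal Z$. Primal-dual Joint Algorithm. Parameters: $\delta>0$, $\gamma>0$, sequences $\alpha_k>0$, $\beta_k>0$, $\epsilon_k\ge0$.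 Initialize $x_1=x_0=\frac1\gamma Z_1$, $y_1=y_0=\frac1\gamma H_1$, $\lambda_1=\lambda_0$. For $k=1,2,\dots$: set $\theta_k=(\alpha_k+\delta)\beta_k$, $\eta_{f,k}=\gamma+\frac1{\alpha_k}+\mu_f\delta\beta_k$, $\eta_{g,k}=\gamma+\frac1{\alpha_k}+\mu_g\delta\beta_k$, $\widetilde\lambda_k=\lambda_k-\delta\beta_k(Ax_k+By_k-b)$, $\widetilde x_k=x_k+\frac{Z_k-\gamma x_k}{\eta_{f,k}}$, $\widetilde y_k=y_k+\frac{H_k-\gamma y_k}{\eta_{g,k}}$, and $$(x_{k+1},y_{k+1})=\arg\min_{(x,y)\in\mathcal X\times\mathcal Y}\Big(\mathcal L_{\theta_k}(x,y,\widetilde\lambda_k)+\frac{\eta_{f,k}}{2\alpha_k\beta_k}\|x-\widetilde x_k\|^2+\frac{\eta_{g,k}}{2\alpha_k\beta_k}\|y-\widetilde y_k\|^2+\frac{\epsilon_k}2\|x\|^2+\frac{\epsilon_k}2\|y\|^2\Big);$$ then $(Z_{k+1},H_{k+1})=(\gamma+\frac1{\alpha_k})(x_{k+1},y_{k+1})-\frac1{\alpha_k}(x_k,y_k)$, $(Z^\delta_{k+1},H^\delta_{k+1})=\delta(Z_{k+1},H_{k+1})+(1-\delta\gamma)(x_{k+1},y_{k+1})$, and $\lambda_{k+1}=\lambda_k+\alpha_k\beta_k(AZ^\delta_{k+1}+BH^\delta_{k+1}-b)$. *)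

(* Defs.v *)
From HB Require Import structures.
From mathcomp Require Import all_boot all_order all_algebra.
From mathcomp Require Import all_classical all_reals all_analysis.

Set Implicit Arguments.
Unset Strict Implicit.
Unset Printing Implicit Defensive.

Import Order.TTheory GRing.Theory Num.Theory.
Import numFieldNormedType.Exports.

Local Open Scope classical_set_scope.
Local Open Scope ring_scope.

(* A real Hilbert space: a complete normed module whose norm (hence topology)
   comes from a symmetric positive definite bilinear form. *)
HB.mixin Record CompleteNormedModule_isHilbert (R : realType) V
    & CompleteNormedModule R V := {
  inner : {dot V for @idfun R} ;
  innerE : forall x : V, inner x x = `|x| ^+ 2
}.

#[short(type="hilbertType")]
HB.structure Definition Hilbert (R : realType) :=
  {V of CompleteNormedModule R V & CompleteNormedModule_isHilbert R V}.

Notation "''[' u , v ]" := (inner u v) : ring_scope.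

Definition proper_efun (T : Type) (R : realType) (f : T -> \bar R) :=
  (forall x, f x != -oo%E) /\ exists x, (f x < +oo)%E.

(* At the end points of the interval the convention is 0 * +oo = 0. *)
Definition convex_efun (R : realType) (X : hilbertType R) (f : X -> \bar R) :=
  forall (x y : X) (t : R), 0 <= t <= 1 ->
    (f (t *: x + (1 - t) *: y)%R <= t%:E * f x + (1 - t)%:E * f y)%E.

Definition closed_efun (R : realType) (X : hilbertType R) (f : X -> \bar R) :=
  closed [set p : X * R | (f p.1 <= p.2%:E)%E].

(* For a proper f the subdifferential is empty where f is +oo. *)
Definition subdifferential (R : realType) (X : hilbertType R)
    (f : X -> \bar R) (x : X) : set X :=
  [set w | forall y, (f x + '[w, y - x]%:E <= f y)%E].

Definition S0 (R : realType) (X : hilbertType R) (mu : R)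
    : set (X -> \bar R) :=
  [set f | [/\ proper_efun f, closed_efun f, lower_semicontinuous f,
     convex_efun f &
     forall x1 x2 w, subdifferential f x2 w ->
       ((mu / 2 * `|x1 - x2| ^+ 2)%:E <=
          f x1 - f x2 - '[w, x1 - x2]%:E)%E]].

Definition argmin (R : realType) (T : Type) (J : T -> \bar R) : set T :=
  [set p | forall q, (J p <= J q)%E].

Definition objective (R : realType) (X Y : Type)
    (f : X -> \bar R) (g : Y -> \bar R) (x : X) (y : Y) : \bar R :=
  (f x + g y)%E.

Definition optimal_solutions (R : realType) (X Y Z : hilbertType R)
    (f : X -> \bar R) (g : Y -> \bar R)
    (A : X -> Z) (B : Y -> Z) (b : Z) : set (X * Y) :=
  [set p | A p.1 + B p.2 = b /\
     forall x y, A x + B y = b ->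
       (objective f g p.1 p.2 <= objective f g x y)%E].

Definition lagrangian (R : realType) (X Y Z : hilbertType R)
    (f : X -> \bar R) (g : Y -> \bar R)
    (A : X -> Z) (B : Y -> Z) (b : Z)
    (x : X) (y : Y) (lam : Z) : \bar R :=
  (f x + g y + '[lam, A x + B y - b]%:E)%E.

Definition augmented_lagrangian (R : realType) (X Y Z : hilbertType R)
    (f : X -> \bar R) (g : Y -> \bar R)
    (A : X -> Z) (B : Y -> Z) (b : Z) (theta : R)
    (x : X) (y : Y) (lam : Z) : \bar R :=
  (lagrangian f g A B b x y lam
     + (theta / 2 * `|A x + B y - b| ^+ 2)%:E)%E.

Definition saddle_points (R : realType) (X Y Z : hilbertType R)
    (f : X -> \bar R) (g : Y -> \bar R)
    (A : X -> Z) (B : Y -> Z) (b : Z) : set (X * Y * Z) :=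
  [set s | let: (xs, ys, lams) := s in
     forall x y lam,
       (lagrangian f g A B b xs ys lam <=
          lagrangian f g A B b xs ys lams)%E /\
       (lagrangian f g A B b xs ys lams <=
          lagrangian f g A B b x y lams)%E].

Definition pdja_init (R : realType) (X Y Z : hilbertType R) (gamma : R)
    (x Zs : nat -> X) (y Hs : nat -> Y) (lam : nat -> Z) : Prop :=
  [/\ x 1%N = x 0%N /\ x 0%N = gamma^-1 *: Zs 1%N,
      y 1%N = y 0%N /\ y 0%N = gamma^-1 *: Hs 1%N &
      lam 1%N = lam 0%N].

(* The k-th iteration; the minimized function is strongly convex, so its argmin
   has at most one element and membership determines (x_{k+1}, y_{k+1}). *)
Definition pdja_step (R : realType) (X Y Z : hilbertType R)
    (f : X -> \bar R) (g : Y -> \bar R)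
    (A : X -> Z) (B : Y -> Z) (b : Z) (mu_f mu_g delta gamma : R)
    (alpha beta eps : nat -> R)
    (x Zs : nat -> X) (y Hs : nat -> Y) (lam : nat -> Z) (k : nat) : Prop :=
  let theta := (alpha k + delta) * beta k in
  let eta_f := gamma + (alpha k)^-1 + mu_f * delta * beta k in
  let eta_g := gamma + (alpha k)^-1 + mu_g * delta * beta k in
  let lamt := lam k - (delta * beta k) *: (A (x k) + B (y k) - b) in
  let xt := x k + eta_f^-1 *: (Zs k - gamma *: x k) in
  let yt := y k + eta_g^-1 *: (Hs k - gamma *: y k) in
  let J (p : X * Y) : \bar R :=
    (augmented_lagrangian f g A B b theta p.1 p.2 lamt
     + (eta_f / (2 * alpha k * beta k) * `|p.1 - xt| ^+ 2)%:E
     + (eta_g / (2 * alpha k * beta k) * `|p.2 - yt| ^+ 2)%:E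
     + (eps k / 2 * `|p.1| ^+ 2)%:E + (eps k / 2 * `|p.2| ^+ 2)%:E)%E in
  let Zd := delta *: Zs k.+1 + (1 - delta * gamma) *: x k.+1 in
  let Hd := delta *: Hs k.+1 + (1 - delta * gamma) *: y k.+1 in
  [/\ argmin J (x k.+1, y k.+1),
      Zs k.+1 = (gamma + (alpha k)^-1) *: x k.+1 - (alpha k)^-1 *: x k,
      Hs k.+1 = (gamma + (alpha k)^-1) *: y k.+1 - (alpha k)^-1 *: y k &
      lam k.+1 = lam k + (alpha k * beta k) *: (A Zd + B Hd - b)].

(* Here x, y, lam are the iterates and Zs, Hs the auxiliary sequences Z_k, H_k
   (Zs k.+1 and Hs k.+1 being produced by iteration k). *)
Definition pdja_generated (R : realType) (X Y Z : hilbertType R)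
    (f : X -> \bar R) (g : Y -> \bar R)
    (A : X -> Z) (B : Y -> Z) (b : Z) (mu_f mu_g delta gamma : R)
    (alpha beta eps : nat -> R)
    (x Zs : nat -> X) (y Hs : nat -> Y) (lam : nat -> Z) : Prop :=
  pdja_init gamma x Zs y Hs lam /\
  forall k, (1 <= k)%N ->
    pdja_step f g A B b mu_f mu_g delta gamma alpha beta eps x Zs y Hs lam k.

(* u = O(v) for an extended-real sequence u: u is eventually finite, so that
   fine loses nothing, and its real values are O(v). (The starting point of the
   algorithm need not lie in the domain of the objective.) *)
Definition ebigO (R : realType) (u : nat -> \bar R) (v : nat -> R) :=
  (\forall k \near \oo, u k \is a fin_num) /\ (fine \o u =O_\oo v).

(* Main.v *)
(* Write r_k = A x_k + B y_k - b and v_k = delta Z_k + (1 - delta gamma) x_k, with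
   h_k built likewise from H_k and y_k. The choice of theta_k makes lam_{k+1}
   the multiplier appearing in the optimality conditions of the subproblem, and
   these turn the iteration into an inertial proximal step on Z_k and H_k.
   Consequently the energy
     |v_k - x_star|^2 / 2 + (delta gamma - 1)/2 |x_k - x_star|^2
     + (the same two terms for h_k, y_k)
     + delta^2 beta_k (L(x_k, y_k, lam_star) - L_star
         + mu_f/2 |x_k - x_star|^2 + mu_g/2 |y_k - y_star|^2
         + eps_k/2 (|x_k|^2 + |y_k|^2))
     + delta/2 |lam_k - lam_star|^2
   increases at step k by at most a multiple of alpha_k beta_k eps_k; the growth
   condition on beta absorbs the change of weight from beta_k to beta_{k+1}.
   Boundedness of the energy yields the Lagrangian rate and the bounds on v_k
   and lam_k; x_{k+1} is a convex combination of x_k and v_{k+1}, hence bounded.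
   The rate on r_k comes from a similar convex recursion for
   delta beta_k r_k - (lam_k - lam_star). The starting point may lie outside the
   domain of the objective, so the energy is only followed from k = 2 on. *)

Require Import Defs.
From HB Require Import structures.
From mathcomp Require Import all_boot all_order all_algebra.
From mathcomp Require Import all_classical all_reals all_analysis.
From mathcomp Require Import ring lra.

Set Implicit Arguments.
Unset Strict Implicit.
Unset Printing Implicit Defensive.

Import Order.TTheory GRing.Theory Num.Theory.
Import numFieldNormedType.Exports.

Local Open Scope classical_set_scope.
Local Open Scope ring_scope.

(** * Inner product calculus and the Cauchy-Schwarz inequality *)

Section Inner.
Context {R : realType} {H : hilbertType R}.
Implicit Types (u v w : H) (c : R).

Lemma innerC u v : '[u, v] = '[v, u].
Proof. by rewrite (hermC inner u v) expr0 mul1r. Qed.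

Lemma innerDl u v w : '[u + v, w] = '[u, w] + '[v, w].
Proof. exact: linearDl. Qed.

Lemma innerDr u v w : '[w, u + v] = '[w, u] + '[w, v].
Proof. exact: linearDr. Qed.

Lemma innerNl u w : '[- u, w] = - '[u, w].
Proof. exact: linearNl. Qed.

Lemma innerNr u w : '[w, - u] = - '[w, u].
Proof. exact: linearNr. Qed.

Lemma innerZl c u w : '[c *: u, w] = c * '[u, w].
Proof. exact: linearZl_LR. Qed.

Lemma innerZr c u w : '[w, c *: u] = c * '[w, u].
Proof. exact: linearZr_LR. Qed.

Definition inner_linear := (innerDl, innerDr, innerNl, innerNr, innerZl, innerZr).

Lemma inner_ge0 u : 0 <= '[u, u].
Proof. by rewrite innerE exprn_ge0. Qed.

(* Reduces vector identities to scalar ones, which field decides. *)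
Lemma inner_ext u v : (forall w, '[u, w] = '[v, w]) -> u = v.
Proof.
move=> uv; apply/eqP; rewrite -subr_eq0 -normr_eq0 -sqrf_eq0 -innerE.
by rewrite innerDl innerNl uv subrr.
Qed.

Lemma inner_norm_le u v : `|'[u, v]| <= `|u| * `|v|.
Proof.
have [->|v0] := eqVneq v 0.
  by rewrite -(scale0r 0) innerZr mul0r normr0 scale0r normr0 mulr0.
have vv : 0 < `|v| by rewrite normr_gt0.
rewrite -ler_sqr ?nnegrE ?mulr_ge0 // exprMn real_normK ?num_real // -!innerE.
have vv2 : 0 < '[v, v] by rewrite innerE exprn_gt0.
(* This vector is ['[v, v]] times the component of [u] orthogonal to [v]; its squared norm is
   ['[v, v]] times the Cauchy-Schwarz deficit. *)
have := inner_ge0 ('[v, v] *: u - '[u, v] *: v).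
rewrite !inner_linear (innerC v u).
rewrite (_ : _ + _ = '[v, v] * ('[u, u] * '[v, v] - '[u, v] ^+ 2)); last ring.
by rewrite pmulr_rge0 // subr_ge0.
Qed.

Lemma inner_cvg (u_ : H ^nat) u v :
  u_ n @[n --> \oo] --> u -> '[u_ n, v] @[n --> \oo] --> '[u, v].
Proof.
move=> cu; apply/cvgrPdist_lt => e e0.
have v0 := normr_ge0 v.
have d0 : 0 < e / (`|v| + 1) by rewrite divr_gt0 // ltr_wpDl.
move/cvgrPdist_lt : cu => /(_ _ d0); apply: filterS => n.
rewrite ltr_pdivlMr ?ltr_wpDl // -innerNl -innerDl.
have := inner_norm_le (u - u_ n) v; have := normr_ge0 (u - u_ n); nra.
Qed.

End Inner.

Lemma ge0_of_quadratic {R : realType} (a b : R) :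
  (forall t, 0 < t <= 1 -> 0 <= t * a + t ^+ 2 * b) -> 0 <= a.
Proof.
move=> h; rewrite leNgt; apply/negP => a0.
(* If [a < 0], this [s] satisfies [s * |b| <= - a], so at [t = s / 2] the factor [a + t * b] is at
   most [a / 2 < 0]. The summand [- a] in the denominator keeps [s <= 1] and covers [b = 0]. *)
pose s := - a / (- a + `|b|).
have b0 := normr_ge0 b; have b1 := ler_norm b.
have d0 : 0 < - a + `|b| by lra.
have s0 : 0 < s by rewrite divr_gt0 //; lra.
have s1 : s <= 1 by rewrite ler_pdivrMr // mul1r; lra.
have /h : 0 < s / 2 <= 1 by lra.
rewrite (_ : _ + _ = s / 2 * (a + s / 2 * b)); last by field.
rewrite pmulr_rge0; last lra.
have : s * (- a + `|b|) = - a by rewrite /s divfK // gt_eqF.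
nra.
Qed.

(** * Riesz representation of bounded functionals *)

Section Riesz.
Context {R : realType} {H : hilbertType R}.

(* The representing vector minimizes |x|^2 - 2 phi x; minimizing sequences are
   Cauchy by the parallelogram identity. *)
Lemma riesz_representation (phi : {scalar H}) (M : R) :
  (forall x, `|phi x| <= M * `|x|) ->
  exists w, forall x, phi x = '[w, x].
Proof.
move=> phiM.
have phiD x z : phi (x + z) = phi x + phi z by rewrite linearD.
have phiZ c x : phi (c *: x) = c * phi x by rewrite linearZ.
pose q (x : H) : R := '[x, x] - 2 * phi x.
pose E := range q.
have lbq : lbound E (- M ^+ 2).
  move=> _ [x _ <-]; rewrite /q innerE.
  have := phiM x; have := ler_norm (phi x); have := sqr_ge0 (`|x| - M); nra.
have hE : has_inf E by split; [exists (q 0); exists 0 | exists (- M ^+ 2)].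
have infq x : inf E <= q x by apply: ge_inf; [exists (- M ^+ 2)| exists x].
have /choice[u uP] n : exists x, q x < inf E + n.+1%:R^-1.
  have [|_ [x _ <-] ?] := @inf_adherent _ E n.+1%:R^-1 _ hE; last by exists x.
  by rewrite invr_gt0.
(* Since [q] at the midpoint is at least [inf E], the squared distance of [u N] and [u n] is below
   twice the sum of their two errors; errors under [e ^+ 2 / 4] therefore suffice. *)
have par x z : '[x - z, x - z] = 2 * q x + 2 * q z - 4 * q (2^-1 *: (x + z)).
  rewrite /q phiZ phiD !inner_linear (innerC z x); lra.
have cu : cauchy (u n @[n --> \oo]).
  apply: cauchy_exP => e e0; near \oo => N; exists (u N).
  change (\forall n \near \oo, ball (u N) e (u n)).
  near=> n; rewrite -ball_normE /ball_ /=.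
  suff: `|u N - u n| ^+ 2 < e ^+ 2 by rewrite ltr_sqr ?nnegrE // ltW.
  rewrite -innerE par.
  have qN := uP N; have qn := uP n; have := infq (2^-1 *: (u N + u n)).
  have iN : N.+1%:R^-1 < e ^+ 2 / 4.
    by near: N; apply: near_infty_natSinv_lt (PosNum (divr_gt0 (exprn_gt0 2 e0) _)).
  have i_n : n.+1%:R^-1 < e ^+ 2 / 4.
    by near: n; apply: near_infty_natSinv_lt (PosNum (divr_gt0 (exprn_gt0 2 e0) _)).
  move: qN qn iN i_n; move: N.+1%:R^-1 n.+1%:R^-1 => iN i_n; lra.
have /cvg_ex[w uw] : cvg (u n @[n --> \oo]) by apply: cauchy_cvg.
(* First variation: [q (u n + t *: z)] exceeds [q (u n) - 1/(n+1)], and the difference depends on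
   [n] only through ['[u n, z]], so the limit is taken without evaluating [q] at [w]. *)
have var z t : 0 <= t * (2 * ('[w, z] - phi z)) + t ^+ 2 * '[z, z].
  have cv : t * (2 * ('[u n, z] - phi z)) + t ^+ 2 * '[z, z] + n.+1%:R^-1
      @[n --> \oo] --> t * (2 * ('[w, z] - phi z)) + t ^+ 2 * '[z, z] + 0.
    apply: cvgD; last exact: cvg_harmonic.
    apply: cvgD; last exact: cvg_cst.
    apply: cvgMl_tmp; apply: cvgMl_tmp.
    by apply: cvgB; [exact: inner_cvg|exact: cvg_cst].
  rewrite addr0 in cv; apply: (cvgr_to_ge cv); near=> n.
  have := infq (u n + t *: z); have := uP n.
  rewrite /q phiD phiZ !inner_linear (innerC z (u n)); move: n.+1%:R^-1 => i_n; lra.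
exists w => z; apply/eqP; rewrite eq_sym -subr_eq0; apply/eqP.
have h1 := ge0_of_quadratic (fun t _ => var z t).
have h2 := ge0_of_quadratic (fun t _ => var (- z) t).
by rewrite innerNr linearN in h2; lra.
Unshelve. all: by end_near. Qed.

End Riesz.

(** * Adjoints and first-order optimality conditions *)

Lemma adjoint_apply {R : realType} {X Z : hilbertType R} (A : {linear X -> Z})
    (nu : Z) : continuous A -> exists w : X, forall x, '[nu, A x] = '[w, x].
Proof.
move=> /linear_bounded_continuous/linear_boundedP[M [_ /(_ (M + 1))]].
rewrite ltrDl ltr01 => /(_ isT) AM.
pose phi x : R := '[nu, A x].
have phi_linear : scalar phi.
  by move=> c x z; rewrite /phi linearP innerDr innerZr.
pose phiL : {scalar X} := HB.pack phi (GRing.isLinear.Build _ _ _ _ _ phi_linear).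
apply: (@riesz_representation _ _ phiL (`|nu| * (M + 1))) => x.
by rewrite (le_trans (inner_norm_le _ _)) // -mulrA ler_wpM2l.
Qed.

(** Fermat's rule: [q] is quadratic with gradient [w] at [x1]. Minimality is combined with convexity
    on the segment from [x1] to [x], and the first-order term in [t] gives the subgradient
    inequality. *)
Lemma subdifferential_argmin {R : realType} {X : hilbertType R}
    (f : X -> \bar R) (q s : X -> R) (w x1 : X) :
  proper_efun f -> convex_efun f -> f x1 \is a fin_num ->
  (forall t d, q (x1 + t *: d) = q x1 + t * '[w, d] + t ^+ 2 * s d) ->
  (forall x, (f x1 + (q x1)%:E <= f x + (q x)%:E)%E) ->
  subdifferential f x1 (- w).
Proof.
move=> [fNy _] cvx f1 qE fq x.
have := fNy x; case fx : (f x) => [r| |] // _; last by rewrite leey.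
rewrite -(fineK f1) -EFinD lee_fin -subr_ge0.
have /ge0_of_quadratic : forall t, 0 < t <= 1 ->
    0 <= t * (r - fine (f x1) + '[w, x - x1]) + t ^+ 2 * s (x - x1).
  move=> t /andP[t0 t1].
  have := cvx x x1 t; rewrite (ltW t0) t1 => /(_ isT).
  have := fq (x1 + t *: (x - x1)); rewrite qE.
  rewrite (_ : t *: x + (1 - t) *: x1 = x1 + t *: (x - x1)); last first.
    by rewrite scalerBl scale1r scalerBr addrCA.
  rewrite fx -(fineK f1) -!EFinM -!EFinD.
  have := fNy (x1 + t *: (x - x1)).
  case: (f _) => [r'| |] // _; rewrite -?EFinD ?lee_fin //; nra.
by rewrite innerNl opprD opprK addrA.
Qed.

(* c stands for the contribution of the other block of the subproblem. *)
Lemma prox_subgradient {R : realType} {X Z : hilbertType R}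
    (f : X -> \bar R) (A : {linear X -> Z}) (c mult : Z)
    (theta kappa eps : R) (xt x1 : X) :
  proper_efun f -> convex_efun f -> continuous A -> f x1 \is a fin_num ->
  (forall x, (f x1 + ('[mult, A x1 + c] + theta / 2 * `|A x1 + c| ^+ 2
                      + kappa * `|x1 - xt| ^+ 2 + eps / 2 * `|x1| ^+ 2)%:E <=
              f x + ('[mult, A x + c] + theta / 2 * `|A x + c| ^+ 2
                     + kappa * `|x - xt| ^+ 2 + eps / 2 * `|x| ^+ 2)%:E)%E) ->
  exists2 nu, forall x, '[mult + theta *: (A x1 + c), A x] = '[nu, x] &
    subdifferential f x1 (- (nu + (2 * kappa) *: (x1 - xt) + eps *: x1)).
Proof.
move=> fP fC cA f1 minf.
have [nu nuE] := adjoint_apply (mult + theta *: (A x1 + c)) cA.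
exists nu => //.
pose s d := theta / 2 * '[A d, A d] + (kappa + eps / 2) * '[d, d].
apply: (subdifferential_argmin (s := s) fP fC f1 _ minf) => t d.
rewrite (_ : A (x1 + t *: d) + c = (A x1 + c) + t *: A d); last first.
  by rewrite linearD linearZ /= addrAC.
rewrite (_ : x1 + t *: d - xt = (x1 - xt) + t *: d); last by rewrite addrAC.
rewrite -!innerE !(innerDl _ _ d) -nuE /s.
move: (A x1 + c) (A d) (x1 - xt) => r a e.
rewrite !inner_linear (innerC a r) (innerC d e) (innerC d x1); lra.
Qed.

(** The share of one block, [x] or [y], in the energy estimate. Here [w] acts as a subgradient at
    [x1] and [nu] as the adjoint image of the new multiplier; the [nu] term is kept, to be absorbed
    by the multiplier energy once both blocks are added. *)
Lemma block_energy_decrease {R : realType} {H : hilbertType R}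
    (x0 x1 xs z0 z1 v0 v1 w nu : H) (al be de ga mu ep f0 f1 fs : R) :
  0 < al -> 0 < be -> 0 < de -> 0 <= mu -> 0 <= ep -> 0 <= de * ga - 1 ->
  z1 = (ga + al^-1) *: x1 - al^-1 *: x0 ->
  z1 - z0 = - ((al * be) *: (w + nu + ep *: x1)) - (mu * de * be) *: (x1 - x0) ->
  v0 = de *: z0 + (1 - de * ga) *: x0 ->
  v1 = de *: z1 + (1 - de * ga) *: x1 ->
  f1 + '[w, xs - x1] + mu / 2 * `|xs - x1| ^+ 2 <= fs ->
  f1 + '[w, x0 - x1] + mu / 2 * `|x0 - x1| ^+ 2 <= f0 ->
  `|v1 - xs| ^+ 2 / 2 + (de * ga - 1) / 2 * `|x1 - xs| ^+ 2
    + de * (de + al) * be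
      * (f1 - fs + mu / 2 * `|x1 - xs| ^+ 2 + ep / 2 * `|x1| ^+ 2)
    + de * al * be * '[nu, v1 - xs]
  <= `|v0 - xs| ^+ 2 / 2 + (de * ga - 1) / 2 * `|x0 - xs| ^+ 2
    + de ^+ 2 * be
      * (f0 - fs + mu / 2 * `|x0 - xs| ^+ 2 + ep / 2 * `|x0| ^+ 2)
    + de * al * be * (ep / 2 * `|xs| ^+ 2).
Proof.
move=> al0 be0 de0 mu0 ep0 dg z1E dzE v0E v1E hs h0.
have aln0 : al != 0 by rewrite gt_eqF.
pose m := de * ga - 1.
have [e eE] : {e | e = x1 - x0} by exists (x1 - x0).
have [D DE] : {D | D = v1 - v0} by exists (v1 - v0).
have x0E : x0 = x1 - e by rewrite eE subKr.
have z0E : z0 = z1 + (al * be) *: (w + nu + ep *: x1) + (mu * de * be) *: e.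
  by rewrite -[LHS](subKr z1) dzE eE opprD !opprK addrA.
have v1E' : v1 = x1 + (de / al) *: e.
  rewrite v1E z1E x0E; apply: inner_ext => t; rewrite !inner_linear; field.
  exact: aln0.
have DE' : D = - (de *: ((al * be) *: (w + nu + ep *: x1)
                         + (mu * de * be) *: e)) - m *: e.
  rewrite DE v1E v0E z0E x0E /m; apply: inner_ext => t; rewrite !inner_linear.
  ring.
have v0E' : v0 = v1 - D by rewrite DE subKr.
rewrite -subr_ge0.
set lhs := (X in 0 <= _ - X); set rhs := (X in 0 <= X - _).
(* An exact identity: the two subgradient slacks plus nonnegative multiples of squares. The weights
   [de * al * be] (at [xs]) and [de ^+ 2 * be] (at [x0]) add up to the weight of the new gap. *)
have -> : rhs - lhs =
    de * al * be * (fs - (f1 + '[w, xs - x1] + mu / 2 * `|xs - x1| ^+ 2))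
  + de ^+ 2 * be * (f0 - (f1 + '[w, x0 - x1] + mu / 2 * `|x0 - x1| ^+ 2))
  + '[D, D] / 2
  + (m * (de / al + 2^-1) + mu * de ^+ 2 * be + mu * de ^+ 3 * be / al
     + de ^+ 2 * be * ep / 2) * '[e, e]
  + de * al * be * (ep / 2) * '[x1 - xs, x1 - xs].
  rewrite {}/lhs {}/rhs -!innerE.
  have -> : '[v0 - xs, v0 - xs] =
      '[v1 - xs, v1 - xs] - 2 * '[D, v1 - xs] + '[D, D].
    rewrite v0E' !inner_linear (innerC D) (innerC xs D); ring.
  have -> : '[D, v1 - xs] = - (de * al * be * ('[w, v1 - xs] + '[nu, v1 - xs]
      + ep * '[x1, v1 - xs])) - (mu * de ^+ 2 * be + m) * '[e, v1 - xs].
    rewrite DE' !inner_linear; ring.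
  rewrite v1E' x0E /m !inner_linear (innerC xs x1) (innerC e x1).
  rewrite (innerC xs e).
  by field.
have dx := sqr_ge0 `|x1 - xs|; rewrite -innerE in dx.
have ee := inner_ge0 e; have DD := inner_ge0 D.
have dab : 0 < de * al * be by rewrite !mulr_gt0.
have d2b : 0 < de ^+ 2 * be by rewrite mulr_gt0 ?exprn_gt0.
have m0 : 0 <= m * (de / al + 2^-1).
  by rewrite mulr_ge0 // addr_ge0 ?divr_ge0 ?invr_ge0 // ltW.
have muc : 0 <= mu * de ^+ 2 * be + mu * de ^+ 3 * be / al + de ^+ 2 * be * ep / 2.
  by rewrite !addr_ge0 ?divr_ge0 ?mulr_ge0 ?exprn_ge0 // ltW.
have epc : 0 <= de * al * be * (ep / 2) by rewrite mulr_ge0 ?divr_ge0 // ltW.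
apply: addr_ge0; last by rewrite mulr_ge0.
apply: addr_ge0; last by rewrite mulr_ge0 //; lra.
apply: addr_ge0; last by rewrite divr_ge0.
apply: addr_ge0; last by rewrite mulr_ge0 ?(ltW d2b) // subr_ge0.
by rewrite mulr_ge0 ?(ltW dab) // subr_ge0.
Qed.

(** Multiplying the optimality condition by [al * be] leaves [eta] times the displacement; its part
    [ga + al^-1] reconstructs [z1], and its part [mu * de * be] remains as the last term. *)
Lemma block_dynamics {R : realType} {H : hilbertType R}
    (x0 x1 z0 z1 w nu : H) (al be de ga mu ep eta : R) :
  0 < al -> 0 < be -> 0 < eta -> eta = ga + al^-1 + mu * de * be ->
  z1 = (ga + al^-1) *: x1 - al^-1 *: x0 ->
  w = - (nu + (2 * (eta / (2 * al * be))) *: (x1 - (x0 + eta^-1 *: (z0 - ga *: x0)))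
         + ep *: x1) ->
  z1 - z0 = - ((al * be) *: (w + nu + ep *: x1)) - (mu * de * be) *: (x1 - x0).
Proof.
move=> al0 be0 eta0 etaE -> ->.
have -> : (mu * de * be) = eta - ga - al^-1 by rewrite etaE; ring.
apply: inner_ext => t; rewrite !inner_linear; field.
by rewrite !gt_eqF.
Qed.

Lemma saddle_feasible {R : realType} {X Y Z : hilbertType R}
    (f : X -> \bar R) (g : Y -> \bar R) (A : X -> Z) (B : Y -> Z) (b : Z)
    (xs : X) (ys : Y) (lams : Z) :
  proper_efun f -> proper_efun g -> saddle_points f g A B b (xs, ys, lams) ->
  [/\ f xs \is a fin_num, g ys \is a fin_num & A xs + B ys = b].
Proof.
move=> [fNy [x0 fx0]] [gNy [y0 gy0]] sp.
have [fs gs] : f xs \is a fin_num /\ g ys \is a fin_num.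
  have [_] := sp x0 y0 lams; rewrite /lagrangian.
  move: (fNy xs) (gNy ys) (fNy x0) (gNy y0) fx0 gy0.
  by case: (f xs); case: (g ys); case: (f x0); case: (g y0).
split=> //; apply/eqP; rewrite -subr_eq0 -normr_eq0 -sqrf_eq0 -innerE.
(* Shifting the multiplier by the residual raises the Lagrangian by the squared residual norm, which
   the saddle inequality forces to be at most 0. *)
have [+ _] := sp xs ys (lams + (A xs + B ys - b)).
rewrite /lagrangian -(fineK fs) -(fineK gs) -!EFinD lee_fin innerDl.
by move=> h; rewrite eq_le inner_ge0 andbT; lra.
Qed.

Lemma block_min {R : realType} (u v w : \bar R) (p q : R) :
  w \is a fin_num -> (u + w + p%:E <= v + w + q%:E)%E ->
  (u + p%:E <= v + q%:E)%E.
Proof.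
move=> wf; rewrite ![(_ + w)%E]addeC -!addeA -(fineK wf).
by rewrite leeD2lE.
Qed.

(** * One iteration: multiplier update and optimality conditions *)

Section Step.
Context {R : realType} {X Y Z : hilbertType R}.
Context (f : X -> \bar R) (g : Y -> \bar R).
Context (A : {linear X -> Z}) (B : {linear Y -> Z}) (b : Z).
Context (mu_f mu_g delta gamma : R) (alpha beta eps : nat -> R).
Context (x Zs : nat -> X) (y Hs : nat -> Y) (lam : nat -> Z).

(** Substituting [Zs k.+1] gives the extrapolated point as [x k.+1] plus [delta / alpha k] times the
    displacement, and likewise for [y], so only successive residuals enter. *)
Lemma pdja_step_multiplier k : 0 < alpha k ->
  pdja_step f g A B b mu_f mu_g delta gamma alpha beta eps x Zs y Hs lam k ->
  lam k.+1 = lam k + beta k *: ((alpha k + delta) *: (A (x k.+1) + B (y k.+1) - b)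
                               - delta *: (A (x k) + B (y k) - b)).
Proof.
move=> al0 [_ ZE HE ->]; rewrite ZE HE.
have AE u v c d : A (c *: u + d *: v) = c *: A u + d *: A v.
  by rewrite linearD !linearZ.
have BE u v c d : B (c *: u + d *: v) = c *: B u + d *: B v.
  by rewrite linearD !linearZ.
rewrite -![- (_ *: _ : X)]scaleNr -![- (_ *: _ : Y)]scaleNr !(AE, BE).
apply: inner_ext => t.
by rewrite !inner_linear; field; rewrite gt_eqF.
Qed.

Lemma pdja_step_optimality (xs : X) (ys : Y) k :
  continuous A -> continuous B -> proper_efun f -> proper_efun g ->
  convex_efun f -> convex_efun g -> f xs \is a fin_num -> g ys \is a fin_num ->
  0 < alpha k -> 0 < beta k -> 0 < delta -> 0 < gamma -> 0 <= mu_f -> 0 <= mu_g ->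
  pdja_step f g A B b mu_f mu_g delta gamma alpha beta eps x Zs y Hs lam k ->
  [/\ f (x k.+1) \is a fin_num, g (y k.+1) \is a fin_num,
    exists nu w, [/\ forall h, '[lam k.+1, A h] = '[nu, h],
      subdifferential f (x k.+1) w &
      Zs k.+1 - Zs k = - ((alpha k * beta k) *: (w + nu + eps k *: x k.+1))
                       - (mu_f * delta * beta k) *: (x k.+1 - x k)] &
    exists nu w, [/\ forall h, '[lam k.+1, B h] = '[nu, h],
      subdifferential g (y k.+1) w &
      Hs k.+1 - Hs k = - ((alpha k * beta k) *: (w + nu + eps k *: y k.+1))
                       - (mu_g * delta * beta k) *: (y k.+1 - y k)]].
Proof.
move=> cA cB fP gP fC gC fs gs al0 be0 de0 ga0 muf0 mug0 step.
have lamE := pdja_step_multiplier al0 step.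
case: step => + ZE HE _.
set eta_f := gamma + _ + mu_f * _ * _; set eta_g := gamma + _ + mu_g * _ * _.
set lamt := _ - _; set xt := _ + _ *: (Zs k - _); set yt := _ + _ *: (Hs k - _).
have etaf0 : 0 < eta_f.
  by rewrite ltr_pwDl ?addr_gt0 ?invr_gt0 // !mulr_ge0 // ltW.
have etag0 : 0 < eta_g.
  by rewrite ltr_pwDl ?addr_gt0 ?invr_gt0 // !mulr_ge0 // ltW.
set x1 := x k.+1; set y1 := y k.+1; move=> minJ.
pose th := (alpha k + delta) * beta k.
pose Q u v := '[lamt, A u + B v - b] + th / 2 * `|A u + B v - b| ^+ 2
  + eta_f / (2 * alpha k * beta k) * `|u - xt| ^+ 2
  + eta_g / (2 * alpha k * beta k) * `|v - yt| ^+ 2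
  + eps k / 2 * `|u| ^+ 2 + eps k / 2 * `|v| ^+ 2.
have minQ u v : (f x1 + g y1 + (Q x1 y1)%:E <= f u + g v + (Q u v)%:E)%E.
  have := minJ (u, v); rewrite /= /augmented_lagrangian /lagrangian.
  by rewrite -!(addeA (_ + _)%E) -!EFinD !addrA.
(* The minimum is compared with the value at [(xs, ys)], which is finite. *)
have [f1 g1] : f x1 \is a fin_num /\ g y1 \is a fin_num.
  have := minQ xs ys; move: fP.1 gP.1 => /(_ x1) + /(_ y1).
  rewrite -(fineK fs) -(fineK gs).
  by case: (f x1); case: (g y1).
have lamE' : lam k.+1 = lamt + th *: (A x1 + B y1 - b).
  rewrite lamE /lamt /th -/x1 -/y1; apply: inner_ext => t.
  by rewrite !inner_linear; ring.
split=> //.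
(* Freezing [y] at [y1] turns joint minimality into a problem in [u] alone, with constant
   [B y1 - b]. *)
- have h u : (f x1 + ('[lamt, A x1 + (B y1 - b)] + th / 2 * `|A x1 + (B y1 - b)| ^+ 2
           + eta_f / (2 * alpha k * beta k) * `|x1 - xt| ^+ 2
           + eps k / 2 * `|x1| ^+ 2)%:E <=
      f u + ('[lamt, A u + (B y1 - b)] + th / 2 * `|A u + (B y1 - b)| ^+ 2
           + eta_f / (2 * alpha k * beta k) * `|u - xt| ^+ 2
           + eps k / 2 * `|u| ^+ 2)%:E)%E.
    have := block_min g1 (minQ u y1).
    rewrite /Q -!(addrA (A _)).
    move: (fP.1 u) (f1); case: (f x1) => // r1; case: (f u) => [r||] // _ _;
      last by rewrite !leey.
    by rewrite -!EFinD !lee_fin; lra.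
  have [nu nuE sub] := prox_subgradient fP fC cA f1 h.
  exists nu; eexists; split; last first.
  + by apply: (block_dynamics al0 be0 etaf0 _ ZE).
  + exact: sub.
  + by move=> d; rewrite -nuE lamE' addrA.
- have h v : (g y1 + ('[lamt, B y1 + (A x1 - b)] + th / 2 * `|B y1 + (A x1 - b)| ^+ 2
           + eta_g / (2 * alpha k * beta k) * `|y1 - yt| ^+ 2
           + eps k / 2 * `|y1| ^+ 2)%:E <=
      g v + ('[lamt, B v + (A x1 - b)] + th / 2 * `|B v + (A x1 - b)| ^+ 2
           + eta_g / (2 * alpha k * beta k) * `|v - yt| ^+ 2
           + eps k / 2 * `|v| ^+ 2)%:E)%E.
    have := minQ x1 v; rewrite ![(f x1 + _)%E]addeC => /(block_min f1).
    rewrite /Q -!addrA ![A x1 + (_ + _)]addrCA !addrA -!(addrA (B _)).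
    move: (gP.1 v) (g1); case: (g y1) => // r1; case: (g v) => [r||] // _ _;
      last by rewrite !leey.
    by rewrite -!EFinD !lee_fin; lra.
  have [nu nuE sub] := prox_subgradient gP gC cB g1 h.
  exists nu; eexists; split; last first.
  + by apply: (block_dynamics al0 be0 etag0 _ HE).
  + exact: sub.
  + by move=> d; rewrite -nuE lamE' addrCA addrA.
Qed.

End Step.

(** * The energy and its decrease *)

Section Energy.
Context {R : realType} {X Y Z : hilbertType R}.
Context (f : X -> \bar R) (g : Y -> \bar R).
Context (A : {linear X -> Z}) (B : {linear Y -> Z}) (b : Z).
Context (mu_f mu_g delta gamma : R) (alpha beta eps : nat -> R).
Context (x Zs : nat -> X) (y Hs : nat -> Y) (lam : nat -> Z).
Context (xs : X) (ys : Y) (lams : Z).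

(** The real value of the Lagrangian at [(u, v, lams)] minus that at the saddle point, where
    feasibility removes the multiplier term; meaningful where [f] and [g] are finite. *)
Definition lagrangian_gap (u : X) (v : Y) : R :=
  fine (f u) + fine (g v) - fine (f xs) - fine (g ys)
  + '[lams, A u + B v - b].

Definition regularized_gap (ep : R) (u : X) (v : Y) : R :=
  lagrangian_gap u v + mu_f / 2 * `|u - xs| ^+ 2 + mu_g / 2 * `|v - ys| ^+ 2
  + ep / 2 * (`|u| ^+ 2 + `|v| ^+ 2).

Definition kinetic {H : hilbertType R} (hs u z : H) : R :=
  `|delta *: z + (1 - delta * gamma) *: u - hs| ^+ 2 / 2
  + (delta * gamma - 1) / 2 * `|u - hs| ^+ 2.

Definition energy (k : nat) : R :=
  kinetic xs (x k) (Zs k) + kinetic ys (y k) (Hs k)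
  + delta ^+ 2 * beta k * regularized_gap (eps k) (x k) (y k)
  + delta / 2 * `|lam k - lams| ^+ 2.

Lemma lagrangian_gap_ge0 u v :
  proper_efun f -> proper_efun g -> saddle_points f g A B b (xs, ys, lams) ->
  f u \is a fin_num -> g v \is a fin_num -> 0 <= lagrangian_gap u v.
Proof.
move=> fP gP sp fu gv; have [fs gs feas] := saddle_feasible fP gP sp.
have [_] := sp u v lams; rewrite /lagrangian feas subrr.
rewrite -(fineK fs) -(fineK gs) -(fineK fu) -(fineK gv) -!EFinD lee_fin.
by rewrite -(scale0r 0) innerZr mul0r /lagrangian_gap; lra.
Qed.

Lemma kinetic_ge0 {H : hilbertType R} (hs u z : H) :
  0 <= delta * gamma - 1 -> 0 <= kinetic hs u z.
Proof. by move=> dg; rewrite addr_ge0 ?mulr_ge0 ?exprn_ge0. Qed.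

Lemma lagrangian_gap_le_regularized ep u v : 0 <= mu_f -> 0 <= mu_g -> 0 <= ep ->
  lagrangian_gap u v <= regularized_gap ep u v.
Proof.
move=> muf0 mug0 ep0; rewrite /regularized_gap.
have ? : 0 <= mu_f / 2 * `|u - xs| ^+ 2 by rewrite mulr_ge0 ?divr_ge0.
have ? : 0 <= mu_g / 2 * `|v - ys| ^+ 2 by rewrite mulr_ge0 ?divr_ge0.
have ? : 0 <= ep / 2 * (`|u| ^+ 2 + `|v| ^+ 2).
  by rewrite mulr_ge0 ?divr_ge0 ?addr_ge0.
lra.
Qed.

Lemma energy_decrease k :
  continuous A -> continuous B -> S0 mu_f f -> S0 mu_g g ->
  saddle_points f g A B b (xs, ys, lams) ->
  0 <= mu_f -> 0 <= mu_g -> 0 < delta -> 0 < gamma -> 0 <= delta * gamma - 1 ->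
  0 < alpha k -> 0 < beta k -> 0 < beta k.+1 ->
  delta * beta k.+1 <= delta * beta k + alpha k * beta k ->
  0 <= eps k.+1 <= eps k ->
  f (x k) \is a fin_num -> g (y k) \is a fin_num ->
  pdja_step f g A B b mu_f mu_g delta gamma alpha beta eps x Zs y Hs lam k ->
  energy k.+1 <= energy k
    + alpha k * beta k * eps k * (delta / 2 * (`|xs| ^+ 2 + `|ys| ^+ 2)).
Proof.
move=> cA cB [fP _ _ fC fS] [gP _ _ gC gS] sp muf0 mug0 de0 ga0 dg al0 be0 be10.
move=> growth /andP[ep1 epk] f0 g0 step.
have [fs gs feas] := saddle_feasible fP gP sp.
have lamE := pdja_step_multiplier al0 step.
have [f1 g1 [nuf [wf [nufE wfS dZ]]] [nug [wg [nugE wgS dH]]]] :=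
  pdja_step_optimality cA cB fP gP fC gC
  fs gs al0 be0 de0 ga0 muf0 mug0 step.
have [_ ZE HE lamE'] := step.
have fsub u : f u \is a fin_num -> fine (f (x k.+1)) + '[wf, u - x k.+1]
    + mu_f / 2 * `|u - x k.+1| ^+ 2 <= fine (f u).
  move=> fu; have := fS u _ _ wfS.
  by rewrite -(fineK fu) -(fineK f1) -!EFinB lee_fin; lra.
have gsub u : g u \is a fin_num -> fine (g (y k.+1)) + '[wg, u - y k.+1]
    + mu_g / 2 * `|u - y k.+1| ^+ 2 <= fine (g u).
  move=> gu; have := gS u _ _ wgS.
  by rewrite -(fineK gu) -(fineK g1) -!EFinB lee_fin; lra.
have ep0 := le_trans ep1 epk.
have bx := block_energy_decrease
  al0 be0 de0 muf0 ep0 dg ZE dZ erefl erefl (fsub _ fs) (fsub _ f0).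
have by_ := block_energy_decrease
  al0 be0 de0 mug0 ep0 dg HE dH erefl erefl (gsub _ gs) (gsub _ g0).
rewrite -nufE in bx; rewrite -nugE in by_.
have gap0 := lagrangian_gap_ge0 fP gP sp f1 g1.
set v1 := _ + _ *: x k.+1 in bx lamE'; set h1 := _ + _ *: y k.+1 in by_ lamE'.
(* By feasibility of [(xs, ys)], the two kept [nu] terms combine into ['[lam k.+1, D]]. Polarization
   around [lams] splits it into the change of the multiplier energy, a square, and ['[lams, D]],
   which completes the Lagrangian gaps. *)
pose D := lam k.+1 - lam k.
have DE : alpha k * beta k * ('[lam k.+1, A (v1 - xs)] + '[lam k.+1, B (h1 - ys)])
    = '[lam k.+1, D].
  have -> : D = (alpha k * beta k) *: (A v1 + B h1 - b).
    by rewrite /D lamE' addrAC subrr add0r.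
  rewrite innerZr -innerDr ![A (_ - _)]linearB ![B (_ - _)]linearB -feas.
  by rewrite opprD addrACA.
have polar : '[lam k.+1, D] = `|lam k.+1 - lams| ^+ 2 / 2 - `|lam k - lams| ^+ 2 / 2
    + '[D, D] / 2 + '[lams, D].
  rewrite -!innerE /D !inner_linear (innerC (lam k) (lam k.+1)).
  rewrite (innerC lams (lam k.+1)) (innerC lams (lam k)); lra.
have lamsD : '[lams, D] = beta k * ((alpha k + delta)
      * '[lams, A (x k.+1) + B (y k.+1) - b]
      - delta * '[lams, A (x k) + B (y k) - b]).
  have -> : D = beta k *: ((alpha k + delta) *: (A (x k.+1) + B (y k.+1) - b)
      - delta *: (A (x k) + B (y k) - b)).
    by rewrite /D lamE addrAC subrr add0r.
  by rewrite innerZr innerDr innerNr !innerZr.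
have DD := inner_ge0 D.
(* The growth condition enlarges the weight, which is legitimate because the gap is nonnegative;
   monotonicity of [eps] handles the regularization. *)
have mono : delta ^+ 2 * beta k.+1 * regularized_gap (eps k.+1) (x k.+1) (y k.+1)
    <= delta * (delta + alpha k) * beta k * regularized_gap (eps k) (x k.+1) (y k.+1).
  have reg0 : 0 <= regularized_gap (eps k.+1) (x k.+1) (y k.+1).
    apply: le_trans gap0 _; exact: lagrangian_gap_le_regularized.
  apply: ler_pM => //; first by rewrite mulr_ge0 ?exprn_ge0 ?ltW.
    by rewrite expr2 -!mulrA ler_wpM2l ?(ltW de0) // mulrDl.
  by rewrite /regularized_gap lerD2l ler_wpM2r ?addr_ge0 ?exprn_ge0 // ler_wpM2r.
have key := lerD bx by_.
have bound : delta * alpha k * beta k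
   * ('[lam k.+1, A (v1 - xs)] + '[lam k.+1, B (h1 - ys)]) =
   delta * ('[lam k.+1, D]) by rewrite -DE; ring.
rewrite polar lamsD in bound.
have dDD : 0 <= delta * '[D, D] by rewrite mulr_ge0 // ltW.
rewrite /energy /kinetic -/v1 -/h1; move: mono key.
move: (_ * regularized_gap (eps k.+1) _ _) => G.
rewrite /regularized_gap /lagrangian_gap; lra.
Qed.

End Energy.

(** * Bounded recursions and the residual rate *)

Lemma convex_recursion_bounded {R : realType} {V : normedModType R}
    (s w : nat -> V) (c : nat -> R) (C : R) :
  (forall k, (1 <= k)%N -> 0 <= c k) ->
  (forall k, (1 <= k)%N -> (1 + c k) *: s k.+1 = s k + c k *: w k) ->
  `|s 1%N| <= C -> (forall k, (1 <= k)%N -> `|w k| <= C) ->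
  forall k, (1 <= k)%N -> `|s k| <= C.
Proof.
move=> c0 rec s1 wC; elim=> [//|[_ _|k IH _]]; first exact: s1.
have ck := c0 k.+1 isT; have := IH isT => {}IH.
(* After division by [1 + c k.+1] the new term is a convex combination of two points in the ball of
   radius [C]. *)
have : `|(1 + c k.+1) *: s k.+2| <= (1 + c k.+1) * C.
  rewrite rec // mulrDl mul1r (le_trans (ler_normD _ _)) // lerD //.
  by rewrite normrZ ger0_norm // ler_wpM2l // wC.
by rewrite normrZ ger0_norm ?addr_ge0 // ler_pM2l // ltr_wpDr.
Qed.

Lemma almost_decreasing_bounded {R : realType} (E a : nat -> R) (c : R) (n : nat) :
  0 <= c -> (forall k, (n <= k)%N -> 0 <= a k) ->
  (forall k, (n <= k)%N -> E k.+1 <= E k + a k * c) ->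
  (\sum_(n <= k <oo) (a k)%:E < +oo)%E ->
  exists C, forall k, (n <= k)%N -> E k <= C.
Proof.
move=> c0 a0 Ea sa.
have ps k : (\sum_(n <= i < k) (a i)%:E <= \sum_(n <= i <oo) (a i)%:E)%E.
  by apply: nneseries_lim_ge => i ni _; rewrite lee_fin a0.
have sfin : (\sum_(n <= i <oo) (a i)%:E)%E \is a fin_num.
  by rewrite ge0_fin_numE // nneseries_ge0 // => i ni _; rewrite lee_fin a0.
have EC k : (n <= k)%N -> E k <= E n + (\sum_(n <= i < k) a i) * c.
  elim: k => [|k IH].
    by rewrite leqn0 => /eqP ->; rewrite big_nil mul0r addr0.
  rewrite leq_eqVlt => /predU1P[->|]; first by rewrite big_geq // mul0r addr0.
  rewrite ltnS => nk; rewrite big_nat_recr //= mulrDl addrA.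
  by rewrite (le_trans (Ea k nk)) // lerD2r IH.
exists (E n + fine (\sum_(n <= i <oo) (a i)%:E) * c) => k nk.
rewrite (le_trans (EC k nk)) // lerD2l ler_wpM2r //.
by rewrite -lee_fin fineK // -sumEFin ps.
Qed.

(** A bound free of square roots, enough for boundedness claims. *)
Lemma norm_le_of_sqr {R : realType} {V : normedModType R} (v : V) (c : R) :
  `|v| ^+ 2 <= c -> `|v| <= c + 1.
Proof. by have := sqr_ge0 (`|v| - 2^-1); lra. Qed.

Lemma eqO_inv {R : realType} (u beta : nat -> R) (M : R) :
  (forall k, (2 <= k)%N -> 0 < beta k) ->
  (forall k, (2 <= k)%N -> `|u k| <= M / beta k) ->
  u =O_\oo (fun k => (beta k)^-1).
Proof.
move=> b0 uM; apply/eqO_exP; exists (`|M| + 1); first by rewrite ltr_wpDl.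
near=> k.
have k2 : (2 <= k)%N by near: k; exact: nbhs_infty_ge.
have bk := b0 k k2.
apply: le_trans (uM k k2) _.
rewrite [X in _ <= _ * X]ger0_norm ?invr_ge0 ?(ltW bk) //.
by apply: ler_wpM2r; [rewrite invr_ge0 ltW | have := ler_norm M; lra].
Unshelve. all: by end_near. Qed.

(* The shifted sequence delta beta_k r_k - (lam_k - lams) obeys a convex
   recursion driven by the bounded multiplier errors. *)
Lemma residual_rate {R : realType} {Z : hilbertType R} (r lam : nat -> Z)
    (lams : Z) (alpha beta : nat -> R) (delta L : R) :
  0 < delta -> (forall k, (1 <= k)%N -> 0 < beta k) ->
  (forall k, (1 <= k)%N -> delta * beta k.+1 <= delta * beta k + alpha k * beta k) ->
  (forall k, (1 <= k)%N -> lam k.+1 = lam k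
     + beta k *: ((alpha k + delta) *: r k.+1 - delta *: r k)) ->
  (forall k, (2 <= k)%N -> `|lam k - lams| <= L) ->
  exists P, forall k, (2 <= k)%N -> `|r k| <= P / beta k.
Proof.
move=> de0 be0 growth lamE lamL.
have db0 k : (1 <= k)%N -> 0 < delta * beta k by move=> k1; rewrite mulr_gt0 ?be0.
(* Chosen so that [1 + c k] times [delta * beta k.+1] is the coefficient of [r k.+1] in the
   multiplier update; the growth condition says exactly [c k >= 0]. *)
pose c k := (alpha k + delta) * beta k / (delta * beta k.+1) - 1.
pose s k := (delta * beta k) *: r k - (lam k - lams).
(* The index [k.+1] lets a multiplier bound valid from 2 on serve the recursion from 1 on. *)
pose w k := - (lam k.+1 - lams).
have c0 k : (1 <= k)%N -> 0 <= c k.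
  move=> k1; rewrite subr_ge0 ler_pdivlMr ?db0 // mul1r mulrDl addrC.
  exact: growth.
have rec k : (1 <= k)%N -> (1 + c k) *: s k.+1 = s k + c k *: w k.
  move=> k1; have b1 := be0 k.+1 isT.
  rewrite /s /w /c lamE //; apply: inner_ext => t; rewrite !inner_linear; field.
  by rewrite !gt_eqF.
pose C := Num.max `|s 1%N| L.
have sC := convex_recursion_bounded (C := C) c0 rec.
have {}sC k : (1 <= k)%N -> `|s k| <= C.
  apply: sC; first by rewrite le_max lexx.
  by move=> j j1; rewrite normrN le_max lamL ?orbT.
exists ((C + L) / delta) => k k2; have k1 := ltnW k2.
rewrite -mulrA -invfM ler_pdivlMr ?db0 //.
rewrite mulrC -[X in X * _](gtr0_norm (db0 k k1)) -normrZ.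
rewrite -(subrK (lam k - lams) (_ *: r k)) (le_trans (ler_normD _ _)) //.
by rewrite lerD ?sC ?lamL.
Qed.

Lemma kinetic_iterates_bounded {R : realType} {H : hilbertType R}
    (x z : nat -> H) (xs : H) (alpha : nat -> R) (delta gamma C : R) :
  0 < delta -> 0 <= delta * gamma - 1 ->
  (forall k, (1 <= k)%N -> 0 < alpha k) ->
  (forall k, (1 <= k)%N ->
     z k.+1 = (gamma + (alpha k)^-1) *: x k.+1 - (alpha k)^-1 *: x k) ->
  (forall k, (2 <= k)%N -> kinetic delta gamma xs (x k) (z k) <= C) ->
  exists M, forall k, (1 <= k)%N -> `|x k| <= M.
Proof.
move=> de0 dg al0 zE kC.
pose v k := delta *: z k.+1 + (1 - delta * gamma) *: x k.+1.
(* The kinetic bound gives [|v k - xs| ^+ 2 <= 2 * C], hence [|v k - xs| <= 2 * C + 1]. *)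
pose M := Num.max `|x 1%N| (2 * C + 1 + `|xs|).
exists M; apply: (convex_recursion_bounded (w := v) (c := fun k => alpha k / delta)).
- by move=> k k1; rewrite divr_ge0 ?ltW ?al0.
- move=> k k1; have ak := al0 k k1; rewrite /v zE //.
  by apply: inner_ext => t; rewrite !inner_linear; field; rewrite !gt_eqF.
- by rewrite le_max lexx.
move=> k k1; rewrite le_max -(subrK xs (v k)); apply/orP; right.
rewrite (le_trans (ler_normD _ _)) // lerD2r norm_le_of_sqr //.
have := kC k.+1 k1; rewrite /kinetic -/(v k).
have : 0 <= (delta * gamma - 1) / 2 * `|x k.+1 - xs| ^+ 2.
  by rewrite mulr_ge0 ?divr_ge0.
lra.
Qed.

(** * Boundedness of the iterates and convergence rates *)

Unset Implicit Arguments.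
Set Strict Implicit.

Theorem theorem1 (R : realType) (X Y Z : hilbertType R)
    (f : X -> \bar R) (g : Y -> \bar R)
    (A : {linear X -> Z}) (B : {linear Y -> Z}) (b : Z)
    (mu_f mu_g delta gamma : R) (alpha beta eps : nat -> R)
    (x Zs : nat -> X) (y Hs : nat -> Y) (lam : nat -> Z)
    (xs : X) (ys : Y) (lams : Z)
    (contA : continuous A) (contB : continuous B)
    (mu_f_ge0 : 0 <= mu_f) (mu_g_ge0 : 0 <= mu_g)
    (fS : S0 mu_f f) (gS : S0 mu_g g)
    (solvable : optimal_solutions f g A B b !=set0)
    (delta_gt0 : 0 < delta) (gamma_gt0 : 0 < gamma)
    (beta_gt0 : forall k, (1 <= k)%N -> 0 < beta k)
    (beta_nd : forall j k, (1 <= j <= k)%N -> beta j <= beta k)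
    (beta_oo : beta k @[k --> \oo] --> +oo)
    (alpha_gt0 : forall k, (1 <= k)%N -> 0 < alpha k)
    (delta_gamma : 0 <= delta * gamma - 1)
    (beta_growth : forall k, (1 <= k)%N ->
      delta * beta k.+1 <= delta * beta k + alpha k * beta k)
    (eps_ge0 : forall k, (1 <= k)%N -> 0 <= eps k)
    (eps_ni : forall j k, (1 <= j <= k)%N -> eps k <= eps j)
    (eps_summable :
      (\sum_(1 <= k <oo) (alpha k * beta k * eps k)%:E < +oo)%E)
    (generated : pdja_generated f g A B b mu_f mu_g delta gamma
       alpha beta eps x Zs y Hs lam)
    (saddle : saddle_points f g A B b (xs, ys, lams)) :
  [/\ [bounded (x k, y k, lam k) | k in [set k | (1 <= k)%N]],
      ebigO (fun k => (lagrangian f g A B b (x k) (y k) lams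
                       - lagrangian f g A B b xs ys lams)%E)
            (fun k => (beta k)^-1),
      ebigO (fun k => `|objective f g (x k) (y k) - objective f g xs ys|%E)
            (fun k => (beta k)^-1) &
      (fun k => `|A (x k) + B (y k) - b|) =O_\oo (fun k => (beta k)^-1)].
Proof.
case: generated => _ step.
have [fP _ _ fC _] := fS; have [gP _ _ gC _] := gS.
have [fs gs feas] := saddle_feasible fP gP saddle.
have fin k : (2 <= k)%N -> f (x k) \is a fin_num /\ g (y k) \is a fin_num.
  case: k => [|[|k]] // _.
  by have [] := pdja_step_optimality
    contA contB fP gP fC gC fs gs (alpha_gt0 k.+1 isT) (beta_gt0 k.+1 isT)
    delta_gt0 gamma_gt0 mu_f_ge0 mu_g_ge0 (step k.+1 isT).
pose E := energy f g A B b mu_f mu_g delta gamma beta eps x Zs y Hs lam xs ys lams.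
have decr k : (2 <= k)%N -> E k.+1 <= E k
    + alpha k * beta k * eps k * (delta / 2 * (`|xs| ^+ 2 + `|ys| ^+ 2)).
  move=> k2; have k1 := ltnW k2; have [fk gk] := fin k k2.
  apply: energy_decrease => //; rewrite ?alpha_gt0 ?beta_gt0 ?beta_growth //.
  - by rewrite eps_ge0 // eps_ni // k1 leqnSn.
  - exact: step.
have ae0 k : (1 <= k)%N -> 0 <= alpha k * beta k * eps k.
  by move=> k1; rewrite !mulr_ge0 ?eps_ge0 // ltW // ?alpha_gt0 ?beta_gt0.
have sum2 : (\sum_(2 <= k <oo) (alpha k * beta k * eps k)%:E < +oo)%E.
  apply: le_lt_trans eps_summable.
  rewrite [leRHS](nneseries_split 1 1); last by move=> k /ae0.
  by rewrite leeDr // big_nat1 lee_fin ae0.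
have [C EC] : exists C, forall k, (2 <= k)%N -> E k <= C.
  apply: (almost_decreasing_bounded _ _ decr sum2).
    by rewrite mulr_ge0 ?divr_ge0 ?addr_ge0 ?exprn_ge0 // ltW.
  by move=> k k2; rewrite ae0 // ltnW.
have gap0 k : (2 <= k)%N -> 0 <= lagrangian_gap f g A B b xs ys lams (x k) (y k).
  by move=> /fin[? ?]; exact: lagrangian_gap_ge0.
(* All summands of the energy are nonnegative, so each is at most [C]; the regularized gap dominates
   the Lagrangian gap. *)
have parts k : (2 <= k)%N ->
    [/\ kinetic delta gamma xs (x k) (Zs k) <= C,
        kinetic delta gamma ys (y k) (Hs k) <= C,
        delta ^+ 2 * beta k * lagrangian_gap f g A B b xs ys lams (x k) (y k) <= C &
        delta / 2 * `|lam k - lams| ^+ 2 <= C].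
  move=> k2; have k1 := ltnW k2; have := EC k k2; rewrite /E /energy.
  have := kinetic_ge0 xs (x k) (Zs k) delta_gamma.
  have := kinetic_ge0 ys (y k) (Hs k) delta_gamma.
  have dl : 0 <= delta / 2 * `|lam k - lams| ^+ 2.
    by rewrite mulr_ge0 ?divr_ge0 // ltW.
  have db : 0 <= delta ^+ 2 * beta k.
    by rewrite mulr_ge0 ?exprn_ge0 // ltW // beta_gt0.
  have := ler_wpM2l db (lagrangian_gap_le_regularized f g A B b xs ys
    lams (x k) (y k) mu_f_ge0 mu_g_ge0 (eps_ge0 k k1)).
  have := mulr_ge0 db (gap0 k k2).
  by split; lra.
have lamL k : (2 <= k)%N -> `|lam k - lams| <= 2 * C / delta + 1.
  move=> /parts[_ _ _ h]; apply: norm_le_of_sqr.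
  by rewrite ler_pdivlMr //; lra.
have [P rP] := residual_rate
  (r := fun k => A (x k) + B (y k) - b) delta_gt0 beta_gt0 beta_growth
  (fun k k1 => pdja_step_multiplier
    (alpha_gt0 k k1) (step k k1)) lamL.
have gapC k : (2 <= k)%N ->
    lagrangian_gap f g A B b xs ys lams (x k) (y k) <= C / delta ^+ 2 / beta k.
  move=> k2; have bk := beta_gt0 k (ltnW k2); have [_ _ h _] := parts k k2.
  by rewrite -mulrA -invfM ler_pdivlMr ?mulr_gt0 ?exprn_gt0 // mulrC.
have beta2 k : (2 <= k)%N -> 0 < beta k by move=> k2; rewrite beta_gt0 // ltnW.
split.
- have [Mx xM] : exists M, forall k, (1 <= k)%N -> `|x k| <= M.
    apply: (kinetic_iterates_bounded (z := Zs) (xs := xs) (alpha := alpha)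
      (gamma := gamma) (C := C) delta_gt0) => // k.
      by case/step.
    by case/parts.
  have [My yM] : exists M, forall k, (1 <= k)%N -> `|y k| <= M.
    apply: (kinetic_iterates_bounded (z := Hs) (xs := ys) (alpha := alpha)
      (gamma := gamma) (C := C) delta_gt0) => // k.
      by case/step.
    by case/parts.
  (* The energy gives no bound at index 1, so [lam 1] enters separately. *)
  pose Ml := Num.max `|lam 1%N| (2 * C / delta + 1 + `|lams|).
  have lM k : (1 <= k)%N -> `|lam k| <= Ml.
    case: k => [|[|k]] // _; first by rewrite le_max lexx.
    rewrite le_max -[X in `|X|](subrK lams); apply/orP; right.
    by rewrite (le_trans (ler_normD _ _)) // lerD2r lamL.
  exists (Num.max (Num.max Mx My) Ml); split; first exact: num_real.
  move=> M; rewrite 2!gt_max => /andP[/andP[MxM MyM] MlM] k /= k1.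
  rewrite !prod_normE /= !ge_max.
  by rewrite (le_trans (xM k k1) (ltW MxM)) (le_trans (yM k k1) (ltW MyM))
    (le_trans (lM k k1) (ltW MlM)).
- have gapE k : (2 <= k)%N -> (lagrangian f g A B b (x k) (y k) lams
      - lagrangian f g A B b xs ys lams)%E
      = (lagrangian_gap f g A B b xs ys lams (x k) (y k))%:E.
    move=> /fin[fk gk]; rewrite /lagrangian feas subrr.
    rewrite -[in LHS](fineK fs) -[in LHS](fineK gs) -[in LHS](fineK fk)
      -[in LHS](fineK gk).
    rewrite -!EFinD; congr EFin.
    by rewrite -(scale0r 0) innerZr mul0r /lagrangian_gap; ring.
  split; first by exists 2%N => // k /= k2; rewrite gapE.
  apply: (eqO_inv (M := C / delta ^+ 2) beta2) => k k2 /=.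
  by rewrite gapE //= ger0_norm ?gap0 // gapC.
(* The objective error is the Lagrangian gap minus the pairing of [lams] with the residual, so the
   two rates already obtained and Cauchy-Schwarz conclude. *)
- have objE k : (2 <= k)%N -> `|objective f g (x k) (y k) - objective f g xs ys|%E
      = `|lagrangian_gap f g A B b xs ys lams (x k) (y k)
          - '[lams, A (x k) + B (y k) - b]|%:E.
    move=> /fin[fk gk]; rewrite /objective.
    rewrite -[in LHS](fineK fs) -[in LHS](fineK gs) -[in LHS](fineK fk)
      -[in LHS](fineK gk).
    rewrite -!EFinD /=; congr (`|_|%:E).
    by rewrite /lagrangian_gap; ring.
  split; first by exists 2%N => // k /= k2; rewrite objE.
  apply: (eqO_inv (M := C / delta ^+ 2 + `|lams| * P) beta2) => k k2 /=.
  rewrite objE //= normr_id (le_trans (ler_normB _ _)) // mulrDl lerD //.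
    by rewrite ger0_norm ?gap0 // gapC.
  by rewrite (le_trans (inner_norm_le _ _)) // -mulrA ler_wpM2l // rP.
- by apply: (eqO_inv (M := P) beta2) => k k2; rewrite normr_id rP.
Qed.
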